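(* Let $1<p<\infty$ and let $q$ be defined by $1/p+1/q=1$. For each $s_0=\sigma+it\in\mathbb{C}_{1/q}$ the linear functional $\delta_{s_0}$ is bounded on $\mathcal{H}(ces_p)$, and $$\frac1q\,\zeta(\sigma q)^{1/q}\le\|\delta_{s_0}\|\le(p-1)^{1/p}\,\zeta(\sigma q)^{1/q}.$$ Moreover, there is a value $\sigma_p$, depending only on $p$, such that $\|\delta_{s_0}\|=\zeta(p)^{-1/p}$ whenever $\sigma\ge\sigma_p$.
   Context: For $\theta\in\mathbb{R}$, $\mathbb{C}_\theta:=\{s\in\mathbb{C}:\Re(s)>\theta\}$. For $1<p<\infty$, the Ces\`aro sequence space $ces_p$ consists of all complex sequences $(a_n)_{n=1}^\infty$ with $$\|(a_n)_{n=1}^\infty\|_{ces_p}:=\Big(\sum_{n=1}^\infty\Big(\frac1n\sum_{k=1}^n|a_k|\Big)^p\Big)^{1/p}<\infty.$$ $\mathcal{H}(ces_p)$ is the Banach space of all Dirichlet series $f(s)=\sum_{n=1}^\infty a_nn^{-s}$ with $(a_n)_{n=1}^\infty\in ces_p$, with norm $\|f\|_{\mathcal{H}(ces_p)}:=\|(a_n)_{n=1}^\infty\|_{ces_p}$. Every such $f$ converges absolutely on $\mathbb{C}_{1/q}$. For $s_0\in\mathbb{C}_{1/q}$, $\delta_{s_0}:\mathcal{H}(ces_p)\to\mathbb{C}$ is the point evaluation $\delta_{s_0}(f):=f(s_0)$, and $\|\delta_{s_0}\|$ is its norm as a linear functional on $\mathcal{H}(ces_p)$. $\zeta(s)=\sum_{n=1}^\infty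 n^{-s}$ ($\Re(s)>1$) is the Riemann zeta-function. *)

(* Defs.v *)
From Stdlib Require Import Reals Lra Lia FunctionalExtensionality ProofIrrelevance.
From Coquelicot Require Import Coquelicot.
Open Scope R_scope.

(** Sequences [(a_n)_(n >= 1)] are functions on [nat] shifted by one:
    [a n] stands for [a_(n+1)]. *)

(** Real powers of a nonnegative base, with [0 ^ y = 0].
    [Rpower] alone is not suitable here, because [Rpower 0 y = 1]. *)
Definition rpow (x y : R) : R := if Rle_dec x 0 then 0 else Rpower x y.

Lemma rpow_pos x y : 0 < x -> rpow x y = Rpower x y.
Proof. intros H; unfold rpow; destruct (Rle_dec x 0); [lra | reflexivity]. Qed.

Lemma rpow_0 y : rpow 0 y = 0.
Proof. unfold rpow; destruct (Rle_dec 0 0); [reflexivity | lra]. Qed.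

Lemma rpow_gt0 x y : 0 < x -> 0 < rpow x y.
Proof. intros H; rewrite rpow_pos by assumption; apply exp_pos. Qed.

Lemma rpow_ge0 x y : 0 <= rpow x y.
Proof.
unfold rpow; destruct (Rle_dec x 0); [lra | apply Rlt_le, exp_pos].
Qed.

Lemma rpow_eq0 x y : 0 <= x -> rpow x y = 0 -> x = 0.
Proof.
intros Hx H; destruct Hx as [Hx | Hx]; [|easy].
generalize (rpow_gt0 x y Hx); lra.
Qed.

Lemma rpow_mult x y z :
  0 <= x -> 0 <= y -> rpow (x * y) z = rpow x z * rpow y z.
Proof.
intros [Hx | <-] [Hy | <-]; rewrite ?Rmult_0_r, ?Rmult_0_l, ?rpow_0; try ring.
rewrite !rpow_pos; try assumption; [|now apply Rmult_lt_0_compat].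
symmetry; now apply Rpower_mult_distr.
Qed.

Lemma rpow_le x y z : 0 <= z -> x <= y -> rpow x z <= rpow y z.
Proof.
intros Hz Hxy; unfold rpow.
destruct (Rle_dec x 0), (Rle_dec y 0); try lra.
- apply Rlt_le, exp_pos.
- apply Rle_Rpower_l; lra.
Qed.

Lemma rpow_rpow_inv x p : 0 <= x -> p <> 0 -> rpow (rpow x p) (/ p) = x.
Proof.
intros [Hx | <-] Hp; [|now rewrite !rpow_0].
rewrite (rpow_pos x), rpow_pos by (trivial; apply exp_pos).
rewrite Rpower_mult, Rinv_r by assumption; now apply Rpower_1.
Qed.

Lemma rpow_inv_rpow x p : 0 <= x -> p <> 0 -> rpow (rpow x (/ p)) p = x.
Proof.
intros Hx Hp; rewrite <- (Rinv_inv p) at 2.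
apply rpow_rpow_inv; [assumption | now apply Rinv_neq_0_compat].
Qed.

Lemma bernoulli_rpow t p : 0 <= t -> 1 < p -> 1 + p * (t - 1) <= rpow t p.
Proof.
intros [Ht | <-] Hp; [|rewrite rpow_0; lra].
rewrite rpow_pos by assumption; unfold Rpower.
assert (E : forall y, 1 + y <= exp y) by (intros; apply exp_ineq1_le).
pose (w := ln t).
assert (H1 : exp (p * w) = t * exp (p * w - w)).
{ rewrite <- (exp_ln t) at 1 by assumption.
  fold w; rewrite <- exp_plus; f_equal; ring. }
assert (H2 : 1 = t * exp (- w)).
{ rewrite <- (exp_ln t) at 1 by assumption.
  fold w; rewrite <- exp_plus, Rplus_opp_r; now rewrite exp_0. }
assert (H3 : t * (1 + (p * w - w)) <= exp (p * w)).
{ rewrite H1; apply Rmult_le_compat_l; [lra | apply E]. }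
assert (H4 : t * (1 + - w) <= 1).
{ rewrite H2 at 2; apply Rmult_le_compat_l; [lra | apply E]. }
fold w; nra.
Qed.

Lemma rpow_convex x y l p : 0 <= x -> 0 <= y -> 0 <= l <= 1 -> 1 < p ->
  rpow (l * x + (1 - l) * y) p <= l * rpow x p + (1 - l) * rpow y p.
Proof.
intros Hx Hy Hl Hp.
assert (Hz : 0 <= l * x + (1 - l) * y) by nra.
set (z := l * x + (1 - l) * y) in *.
destruct Hz as [Hz | Hz].
2: { rewrite <- Hz, rpow_0.
     generalize (rpow_ge0 x p) (rpow_ge0 y p); nra. }
assert (T : forall u, 0 <= u ->
  rpow z p * (1 + p * (u / z - 1)) <= rpow u p).
{ intros u Hu.
  assert (Hq : 0 <= u / z) by (apply Rdiv_le_0_compat; assumption).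
  replace (rpow u p) with (rpow z p * rpow (u / z) p).
  - apply Rmult_le_compat_l; [apply rpow_ge0 | now apply bernoulli_rpow].
  - rewrite <- rpow_mult by lra; f_equal; field; lra. }
generalize (T x Hx) (T y Hy); intros Tx Ty.
replace (rpow z p) with (l * (rpow z p * (1 + p * (x / z - 1)))
  + (1 - l) * (rpow z p * (1 + p * (y / z - 1)))).
- apply Rplus_le_compat; apply Rmult_le_compat_l; lra.
- transitivity (rpow z p * (1 + p * ((l * x + (1 - l) * y) / z - 1))).
  + field; lra.
  + fold z; field; lra.
Qed.

Lemma Series_ge_term (u : nat -> R) n :
  (forall k, 0 <= u k) -> ex_series u -> u n <= Series u.
Proof.
intros Hu Eu.
apply Rle_trans with (sum_n u n).
- destruct n as [|n]; [rewrite sum_O; lra | rewrite sum_Sn].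
  change (u (S n) <= sum_n u n + u (S n)).
  assert (0 <= sum_n u n); [|lra].
  induction n as [|n IH]; [rewrite sum_O; apply Hu | rewrite sum_Sn].
  change (0 <= sum_n u n + u (S n)); generalize (Hu (S n)); lra.
- apply (is_lim_seq_incr_compare (sum_n u)).
  + exact (Series_correct u Eu).
  + intros k; rewrite sum_Sn; change (sum_n u k <= sum_n u k + u (S k)).
    generalize (Hu (S k)); lra.
Qed.

Lemma Series_ge0 (u : nat -> R) :
  (forall k, 0 <= u k) -> ex_series u -> 0 <= Series u.
Proof.
intros Hu Eu; apply Rle_trans with (u O); [apply Hu | now apply Series_ge_term].
Qed.

Lemma minkowski_series (u v w : nat -> R) p a b :
  1 < p -> 0 < a -> 0 < b ->
  (forall n, 0 <= u n) -> (forall n, 0 <= v n) ->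
  (forall n, w n <= u n + v n) ->
  ex_series (fun n => rpow (u n) p) -> ex_series (fun n => rpow (v n) p) ->
  Series (fun n => rpow (u n) p) <= rpow a p ->
  Series (fun n => rpow (v n) p) <= rpow b p ->
  ex_series (fun n => rpow (w n) p) /\
  Series (fun n => rpow (w n) p) <= rpow (a + b) p.
Proof.
intros Hp Ha Hb Hu Hv Hw Eu Ev Su Sv.
set (l := a / (a + b)).
assert (Hl : 0 <= l <= 1).
{ unfold l; split; [apply Rdiv_le_0_compat; lra|].
  apply (Rmult_le_reg_r (a + b)); [lra | field_simplify; lra]. }
assert (H1 : 1 - l = b / (a + b)) by (unfold l; field; lra).
set (c := rpow (a + b) p * l / rpow a p).
set (d := rpow (a + b) p * (1 - l) / rpow b p).
pose proof (rpow_gt0 a p Ha) as Pa.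
pose proof (rpow_gt0 b p Hb) as Pb.
assert (M : forall n, rpow (w n) p <= c * rpow (u n) p + d * rpow (v n) p).
{ intros n.
  assert (Qa : 0 <= u n / a) by (apply Rdiv_le_0_compat; trivial).
  assert (Qb : 0 <= v n / b) by (apply Rdiv_le_0_compat; trivial).
  apply Rle_trans with (rpow (u n + v n) p); [apply rpow_le; trivial; lra|].
  replace (u n + v n)
    with ((a + b) * (l * (u n / a) + (1 - l) * (v n / b))).
  2: { rewrite H1; unfold l; field; lra. }
  rewrite rpow_mult; [|lra|nra].
  apply Rle_trans with (rpow (a + b) p *
    (l * rpow (u n / a) p + (1 - l) * rpow (v n / b) p)).
  { apply Rmult_le_compat_l; [apply rpow_ge0 | now apply rpow_convex]. }
  apply Req_le; unfold c, d.
  replace (rpow (u n) p) with (rpow (u n / a) p * rpow a p).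
  2: { rewrite <- rpow_mult by lra; f_equal; field; lra. }
  replace (rpow (v n) p) with (rpow (v n / b) p * rpow b p).
  2: { rewrite <- rpow_mult by lra; f_equal; field; lra. }
  field; lra. }
assert (Ec : ex_series (fun n => c * rpow (u n) p))
  by exact (ex_series_scal (K := R_AbsRing) (V := R_NormedModule) c _ Eu).
assert (Ed : ex_series (fun n => d * rpow (v n) p))
  by exact (ex_series_scal (K := R_AbsRing) (V := R_NormedModule) d _ Ev).
assert (E : ex_series (fun n => c * rpow (u n) p + d * rpow (v n) p))
  by exact (ex_series_plus (K := R_AbsRing) (V := R_NormedModule) _ _ Ec Ed).
assert (M' : forall n, 0 <= rpow (w n) p
                         <= c * rpow (u n) p + d * rpow (v n) p).
{ intros n; split; [apply rpow_ge0 | apply M]. }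
split.
- apply (ex_series_le (K := R_AbsRing) (V := R_CompleteNormedModule) _
    (fun n => c * rpow (u n) p + d * rpow (v n) p)); [|exact E].
  intros n; change (Rabs (rpow (w n) p)
    <= c * rpow (u n) p + d * rpow (v n) p).
  rewrite Rabs_pos_eq; apply M'.
- eapply Rle_trans; [exact (Series_le _ _ M' E)|].
  rewrite Series_plus by assumption; rewrite !Series_scal_l.
  assert (Hc : 0 <= c).
  { unfold c; apply Rdiv_le_0_compat; trivial.
    apply Rmult_le_pos; [apply rpow_ge0 | lra]. }
  assert (Hd : 0 <= d).
  { unfold d; apply Rdiv_le_0_compat; trivial.
    apply Rmult_le_pos; [apply rpow_ge0 | lra]. }
  apply Rle_trans with (c * rpow a p + d * rpow b p).
  + apply Rplus_le_compat; now apply Rmult_le_compat_l.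
  + apply Req_le; unfold c, d; field; lra.
Qed.

Definition cesaro_mean (a : nat -> C) (n : nat) : R :=
  / INR (S n) * sum_n (fun k => Cmod (a k)) n.

Definition ces (p : R) (a : nat -> C) : Prop :=
  ex_series (fun n => rpow (cesaro_mean a n) p).

Definition ces_norm (p : R) (a : nat -> C) : R :=
  rpow (Series (fun n => rpow (cesaro_mean a n) p)) (/ p).

Lemma cesaro_mean_ge0 a n : 0 <= cesaro_mean a n.
Proof.
unfold cesaro_mean; apply Rmult_le_pos.
- apply Rlt_le, Rinv_0_lt_compat, lt_0_INR; lia.
- induction n as [|n IH]; [rewrite sum_O; apply Cmod_ge_0 | rewrite sum_Sn].
  change (0 <= sum_n (fun k => Cmod (a k)) n + Cmod (a (S n))).
  generalize (Cmod_ge_0 (a (S n))); lra.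
Qed.

Lemma cesaro_mean_plus a b n :
  cesaro_mean (fun k => Cplus (a k) (b k)) n
    <= cesaro_mean a n + cesaro_mean b n.
Proof.
unfold cesaro_mean; rewrite <- Rmult_plus_distr_l; apply Rmult_le_compat_l.
- apply Rlt_le, Rinv_0_lt_compat, lt_0_INR; lia.
- change (sum_n (fun k => Cmod (Cplus (a k) (b k))) n <=
    plus (sum_n (fun k => Cmod (a k)) n) (sum_n (fun k => Cmod (b k)) n)).
  rewrite <- sum_n_plus; apply sum_n_m_le; intros k; apply Cmod_triangle.
Qed.

Lemma cesaro_mean_scal c a n :
  cesaro_mean (fun k => Cmult c (a k)) n = Cmod c * cesaro_mean a n.
Proof.
unfold cesaro_mean.
rewrite (sum_n_ext _ (fun k => mult (Cmod c) (Cmod (a k))))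
  by (intros; apply Cmod_mult).
rewrite sum_n_mult_l.
match goal with |- _ * mult _ ?t = _ =>
  change (/ INR (S n) * (Cmod c * t) = Cmod c * (/ INR (S n) * t)) end.
ring.
Qed.

Lemma cesaro_mean_opp a n :
  cesaro_mean (fun k => Copp (a k)) n = cesaro_mean a n.
Proof.
unfold cesaro_mean; f_equal; apply sum_n_ext; intros; apply Cmod_opp.
Qed.

Lemma cesaro_mean_zero n : cesaro_mean (fun _ => RtoC 0) n = 0.
Proof.
unfold cesaro_mean.
rewrite (sum_n_ext _ (fun _ => 0)) by (intros; apply Cmod_0).
rewrite sum_n_const; ring.
Qed.

Lemma cesaro_mean_eq0 a : (forall n, cesaro_mean a n = 0) ->
  forall n, a n = RtoC 0.
Proof.
intros H.
assert (S0 : forall n, sum_n (fun k => Cmod (a k)) n = 0).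
{ intros n; generalize (H n); unfold cesaro_mean; intros Hn.
  apply Rmult_integral in Hn as [Hn | Hn]; [|exact Hn].
  exfalso; revert Hn; apply Rinv_neq_0_compat, not_0_INR; lia. }
intros [|n]; apply Cmod_eq_0.
- generalize (S0 O); now rewrite sum_O.
- generalize (S0 (S n)); rewrite sum_Sn, S0.
  change (0 + Cmod (a (S n)) = 0 -> Cmod (a (S n)) = 0); lra.
Qed.

Section Closure.
Variables (p : R) (hp : 1 < p).

Lemma ces_norm_ge0 a : 0 <= ces_norm p a.
Proof. apply rpow_ge0. Qed.

Lemma ces_series_le a r : ces p a -> ces_norm p a <= r ->
  Series (fun n => rpow (cesaro_mean a n) p) <= rpow r p.
Proof.
intros Ha Hr.
rewrite <- (rpow_inv_rpow (Series _) p); [apply rpow_le; [lra | exact Hr]| |lra].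
apply Series_ge0; [intros; apply rpow_ge0 | exact Ha].
Qed.

Lemma ces_plus_aux a b : ces p a -> ces p b ->
  ces p (fun k => Cplus (a k) (b k)) /\
  ces_norm p (fun k => Cplus (a k) (b k)) <= ces_norm p a + ces_norm p b.
Proof.
intros Ha Hb.
pose proof (ces_norm_ge0 a) as Na.
pose proof (ces_norm_ge0 b) as Nb.
assert (M : forall eps, 0 < eps ->
  ces p (fun k => Cplus (a k) (b k)) /\
  Series (fun n => rpow (cesaro_mean (fun k => Cplus (a k) (b k)) n) p)
    <= rpow (ces_norm p a + eps / 2 + (ces_norm p b + eps / 2)) p).
{ intros eps He; apply minkowski_series
    with (u := cesaro_mean a) (v := cesaro_mean b); trivial; try lra.
  - intros; apply cesaro_mean_ge0.
  - intros; apply cesaro_mean_ge0.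
  - intros; apply cesaro_mean_plus.
  - apply ces_series_le; [assumption | lra].
  - apply ces_series_le; [assumption | lra]. }
split; [apply (M 1); lra|].
apply le_epsilon; intros eps He.
destruct (M eps He) as [_ L].
unfold ces_norm at 1.
apply Rle_trans with (rpow (rpow
  (ces_norm p a + eps / 2 + (ces_norm p b + eps / 2)) p) (/ p)).
- apply rpow_le; [apply Rlt_le, Rinv_0_lt_compat; lra | exact L].
- rewrite rpow_rpow_inv by lra; lra.
Qed.

Lemma ces_plus a b : ces p a -> ces p b ->
  ces p (fun k => Cplus (a k) (b k)).
Proof. intros Ha Hb; now apply ces_plus_aux. Qed.

Lemma ces_norm_plus a b : ces p a -> ces p b ->
  ces_norm p (fun k => Cplus (a k) (b k)) <= ces_norm p a + ces_norm p b.
Proof. intros Ha Hb; now apply ces_plus_aux. Qed.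

Lemma ces_zero : ces p (fun _ => RtoC 0).
Proof.
apply (ex_series_ext (fun n => scal 0 ((/ 2) ^ n))).
- intros n; rewrite cesaro_mean_zero, rpow_0; exact (Rmult_0_l _).
- apply (ex_series_scal (K := R_AbsRing) (V := R_NormedModule)).
  exists (/ (1 - / 2)); apply is_series_geom; rewrite Rabs_pos_eq; lra.
Qed.

Lemma ces_scal_series c a :
  (fun n => rpow (cesaro_mean (fun k => Cmult c (a k)) n) p)
  = (fun n => rpow (Cmod c) p * rpow (cesaro_mean a n) p).
Proof.
apply functional_extensionality; intros n; rewrite cesaro_mean_scal.
apply rpow_mult; [apply Cmod_ge_0 | apply cesaro_mean_ge0].
Qed.

Lemma ces_scal c a : ces p a -> ces p (fun k => Cmult c (a k)).
Proof.
intros Ha; unfold ces; rewrite ces_scal_series.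
exact (ex_series_scal (K := R_AbsRing) (V := R_NormedModule) _ _ Ha).
Qed.

Lemma ces_norm_scal c a : ces p a ->
  ces_norm p (fun k => Cmult c (a k)) = Cmod c * ces_norm p a.
Proof.
intros Ha; unfold ces_norm; rewrite ces_scal_series, Series_scal_l, rpow_mult.
- rewrite rpow_rpow_inv; [reflexivity | apply Cmod_ge_0 | lra].
- apply rpow_ge0.
- apply Series_ge0; [intros; apply rpow_ge0 | exact Ha].
Qed.

Lemma ces_opp_series a :
  (fun n => rpow (cesaro_mean (fun k => Copp (a k)) n) p)
  = (fun n => rpow (cesaro_mean a n) p).
Proof.
now apply functional_extensionality; intros n; rewrite cesaro_mean_opp.
Qed.

Lemma ces_opp a : ces p a -> ces p (fun k => Copp (a k)).
Proof. unfold ces; now rewrite ces_opp_series. Qed.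

Lemma ces_norm_opp a : ces_norm p (fun k => Copp (a k)) = ces_norm p a.
Proof. unfold ces_norm; now rewrite ces_opp_series. Qed.

Lemma ces_norm_zero : ces_norm p (fun _ => RtoC 0) = 0.
Proof.
transitivity (ces_norm p (fun _ : nat => Cmult (RtoC 0) (RtoC 0))).
- f_equal; apply functional_extensionality; intros n; now rewrite Cmult_0_l.
- rewrite ces_norm_scal by apply ces_zero; rewrite Cmod_0; ring.
Qed.

Lemma ces_norm_eq0 a : ces p a -> ces_norm p a = 0 -> forall n, a n = RtoC 0.
Proof.
intros Ha H0; apply cesaro_mean_eq0; intros n.
apply (rpow_eq0 _ p); [apply cesaro_mean_ge0|].
apply Rle_antisym; [|apply rpow_ge0].
apply rpow_eq0 in H0.
- rewrite <- H0.
  apply (Series_ge_term (fun n => rpow (cesaro_mean a n) p)); [|exact Ha].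
  intros; apply rpow_ge0.
- apply Series_ge0; [intros; apply rpow_ge0 | exact Ha].
Qed.

End Closure.

(** [n^(-s) = exp (- s * ln n)], split into real and imaginary parts. *)
Definition nat_cpow_opp (n : nat) (s : C) : C :=
  (Rpower (INR n) (- Re s) * cos (Im s * ln (INR n)),
   - (Rpower (INR n) (- Re s) * sin (Im s * ln (INR n)))).

(** The sum [\sum_(n >= 1) a_n n^(-s)]; as for the other operators built on
    [iota], the value is meaningful when the series converges. *)
Definition dirichlet (a : nat -> C) (s : C) : C :=
  iota (fun l : C_CompleteNormedModule =>
    is_series (fun n => Cmult (a n) (nat_cpow_opp (S n) s)) l).

(** The zeta function on the real half-line [x > 1], where it is real. *)
Definition zeta (x : R) : R := Series (fun n => Rpower (INR (S n)) (- x)).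

(** A Dirichlet series is identified with its sequence of coefficients.
    The proof [hp] is a parameter of the type so that the normed space
    structure, which needs it, can be inferred canonically. *)
Record Hces (p : R) (hp : 1 < p) : Type :=
  mkHces { coef : nat -> C; coef_ces : ces p coef }.

Arguments mkHces {p} hp coef coef_ces.
Arguments coef {p hp} h n.
Arguments coef_ces {p hp} h.

Section HcesNormedModule.
Variables (p : R) (hp : 1 < p).
Implicit Types f g h : Hces p hp.

Lemma Hces_ext f g : (forall n, coef f n = coef g n) -> f = g.
Proof.
destruct f as [a Ha], g as [b Hb]; simpl; intros H.
assert (E : a = b) by now apply functional_extensionality.
subst b; f_equal; apply proof_irrelevance.
Qed.

Definition Hces_plus f g : Hces p hp :=
  mkHces hp _ (ces_plus p hp _ _ (coef_ces f) (coef_ces g)).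
Definition Hces_opp f : Hces p hp := mkHces hp _ (ces_opp p _ (coef_ces f)).
Definition Hces_zero : Hces p hp := mkHces hp _ (ces_zero p).
Definition Hces_scal (c : C) f : Hces p hp :=
  mkHces hp _ (ces_scal p c _ (coef_ces f)).
Definition Hces_norm f : R := ces_norm p (coef f).
Definition Hces_ball f (eps : R) g : Prop :=
  Hces_norm (Hces_plus g (Hces_opp f)) < eps.

Lemma Hces_plus_comm f g : Hces_plus f g = Hces_plus g f.
Proof. apply Hces_ext; intros n; apply Cplus_comm. Qed.

Lemma Hces_plus_assoc f g h :
  Hces_plus f (Hces_plus g h) = Hces_plus (Hces_plus f g) h.
Proof. apply Hces_ext; intros n; apply Cplus_assoc. Qed.

Lemma Hces_plus_zero_r f : Hces_plus f Hces_zero = f.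
Proof. apply Hces_ext; intros n; apply Cplus_0_r. Qed.

Lemma Hces_plus_opp_r f : Hces_plus f (Hces_opp f) = Hces_zero.
Proof. apply Hces_ext; intros n; apply Cplus_opp_r. Qed.

Lemma Hces_scal_assoc (x y : C) f :
  Hces_scal x (Hces_scal y f) = Hces_scal (Cmult x y) f.
Proof. apply Hces_ext; intros n; apply Cmult_assoc. Qed.

Lemma Hces_scal_one f : Hces_scal (RtoC 1) f = f.
Proof. apply Hces_ext; intros n; apply Cmult_1_l. Qed.

Lemma Hces_scal_distr_l (x : C) f g :
  Hces_scal x (Hces_plus f g) = Hces_plus (Hces_scal x f) (Hces_scal x g).
Proof. apply Hces_ext; intros n; apply Cmult_plus_distr_l. Qed.

Lemma Hces_scal_distr_r (x y : C) f :
  Hces_scal (Cplus x y) f = Hces_plus (Hces_scal x f) (Hces_scal y f).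
Proof. apply Hces_ext; intros n; apply Cmult_plus_distr_r. Qed.

Lemma Hces_norm_triangle f g :
  Hces_norm (Hces_plus f g) <= Hces_norm f + Hces_norm g.
Proof. now apply ces_norm_plus; try apply coef_ces. Qed.

Lemma Hces_norm_scal (c : C) f :
  Hces_norm (Hces_scal c f) <= Cmod c * Hces_norm f.
Proof. now apply Req_le, ces_norm_scal; try apply coef_ces. Qed.

Lemma Hces_norm_eq0 f : Hces_norm f = 0 -> f = Hces_zero.
Proof.
intros H; apply Hces_ext; intros n; simpl.
now apply (ces_norm_eq0 p); [apply coef_ces|].
Qed.

Lemma Hces_ball_center f (eps : posreal) : Hces_ball f eps f.
Proof.
unfold Hces_ball; rewrite Hces_plus_opp_r.
unfold Hces_norm; simpl; rewrite ces_norm_zero by assumption.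
apply cond_pos.
Qed.

Lemma Hces_ball_sym f g (eps : R) : Hces_ball f eps g -> Hces_ball g eps f.
Proof.
unfold Hces_ball; intros H; eapply Rle_lt_trans; [|exact H].
apply Req_le.
transitivity (ces_norm p (fun k => Copp (coef (Hces_plus g (Hces_opp f)) k))).
- unfold Hces_norm; f_equal; apply functional_extensionality; intros n; simpl.
  ring.
- apply ces_norm_opp.
Qed.

Lemma Hces_ball_triangle f g h (e1 e2 : R) :
  Hces_ball f e1 g -> Hces_ball g e2 h -> Hces_ball f (e1 + e2) h.
Proof.
unfold Hces_ball; intros H1 H2.
replace (Hces_plus h (Hces_opp f))
  with (Hces_plus (Hces_plus h (Hces_opp g)) (Hces_plus g (Hces_opp f))).
- eapply Rle_lt_trans; [apply Hces_norm_triangle | lra].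
- apply Hces_ext; intros n; simpl; ring.
Qed.

Definition Hces_AbelianMonoid_mixin :=
  AbelianMonoid.Mixin (Hces p hp) Hces_plus Hces_zero
    Hces_plus_comm Hces_plus_assoc Hces_plus_zero_r.
Canonical Hces_AbelianMonoid :=
  AbelianMonoid.Pack (Hces p hp) Hces_AbelianMonoid_mixin (Hces p hp).

Definition Hces_AbelianGroup_mixin :=
  AbelianGroup.Mixin Hces_AbelianMonoid Hces_opp Hces_plus_opp_r.
Canonical Hces_AbelianGroup :=
  AbelianGroup.Pack (Hces p hp)
    (AbelianGroup.Class _ Hces_AbelianMonoid_mixin Hces_AbelianGroup_mixin)
    (Hces p hp).

Definition Hces_ModuleSpace_mixin :=
  ModuleSpace.Mixin C_Ring Hces_AbelianGroup Hces_scal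
    Hces_scal_assoc Hces_scal_one Hces_scal_distr_l Hces_scal_distr_r.
Canonical Hces_ModuleSpace :=
  ModuleSpace.Pack C_Ring (Hces p hp)
    (ModuleSpace.Class _ _ _ Hces_ModuleSpace_mixin) (Hces p hp).

Definition Hces_UniformSpace_mixin :=
  UniformSpace.Mixin (Hces p hp) Hces_zero Hces_ball
    Hces_ball_center Hces_ball_sym Hces_ball_triangle.
Canonical Hces_UniformSpace :=
  UniformSpace.Pack (Hces p hp) Hces_UniformSpace_mixin (Hces p hp).

Canonical Hces_NormedModuleAux :=
  NormedModuleAux.Pack C_AbsRing (Hces p hp)
    (NormedModuleAux.Class C_AbsRing (Hces p hp)
       (ModuleSpace.class _ Hces_ModuleSpace) Hces_UniformSpace_mixin)
    (Hces p hp).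

Lemma Hces_norm_ball1 f g (eps : R) :
  Hces_norm (minus g f) < eps -> ball f eps g.
Proof. easy. Qed.

Lemma Hces_norm_ball2 f g (eps : posreal) :
  ball f eps g -> Hces_norm (minus g f) < 1 * eps.
Proof. rewrite Rmult_1_l; easy. Qed.

Definition Hces_NormedModule_mixin :=
  NormedModule.Mixin C_AbsRing Hces_NormedModuleAux Hces_norm 1
    Hces_norm_triangle Hces_norm_scal Hces_norm_ball1 Hces_norm_ball2
    Hces_norm_eq0.
Canonical Hces_NormedModule :=
  NormedModule.Pack C_AbsRing (Hces p hp)
    (NormedModule.Class _ _ _ Hces_NormedModule_mixin) (Hces p hp).

End HcesNormedModule.

Definition delta {p : R} {hp : 1 < p} (s0 : C) (f : Hces p hp) : C :=
  dirichlet (coef f) s0.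

(** The operator norm; it is [p_infty] when [l] is unbounded on the unit ball. *)
Definition opnorm {K : AbsRing} {U V : NormedModule K} (l : U -> V) : Rbar :=
  Lub_Rbar (fun r : R => exists x : U, norm x <= 1 /\ r = norm (l x)).

(* Main.v *)
(* Write m_n for the Cesaro means of |a|, A_n for its partial sums, and S for
   the sum of the m_n^p.  Everything bounds sum_n |a_n| n^(-sigma).

   Upper bound: let B_n be the tail sum_(k >= n) A_k^(p-1) k^(-p).  Summation
   by parts gives sum_n |a_n| B_n <= S, and comparing sum_(k >= n) k^(-p) with
   n^(1-p)/(p-1) gives sum_(n <= N) |a_n| B_n^(1-q) <= (p-1)^(q-1) N, so by Abel
   summation sum_n |a_n| B_n^(1-q) n^(-sigma q) <= (p-1)^(q-1) zeta(sigma q).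
   Holder's inequality, applied to the splitting
   n^(-sigma) = B_n^(1/p) * (B_n^(-1/p) n^(-sigma)) with weights |a_n|,
   combines the two estimates.

   Lower bound: test on a_n = n^(-sigma (q-1) + i t), whose norm is controlled
   by Hardy's inequality.

   Large sigma: the sequence (1, 0, 0, ...) gives the lower bound; the upper one
   holds because Holder bounds sum_n A_n n^(-p) = sum_k |a_k| T_k, where
   T_k = sum_(n >= k) n^(-p), and n^(-sigma) <= T_n / zeta(p) for all n. *)

Require Import Defs.
From Stdlib Require Import Reals Lra Lia.
From Coquelicot Require Import Coquelicot.
Open Scope R_scope.


(** * Partial sums and series of nonnegative reals *)

Lemma sum_n_S (u : nat -> R) n : sum_n u (S n) = sum_n u n + u (S n) :> R.
Proof. now rewrite sum_Sn. Qed.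

Lemma sum_n_0 (u : nat -> R) : sum_n u 0 = u 0%nat :> R.
Proof. apply sum_O. Qed.

Lemma sum_n_ge0 (u : nat -> R) n : (forall k, 0 <= u k) -> 0 <= sum_n u n.
Proof.
intros Hu; induction n as [|n IH]; [rewrite sum_n_0; apply Hu|].
rewrite sum_n_S; generalize (Hu (S n)); lra.
Qed.

Lemma sum_n_incr (u : nat -> R) n m :
  (forall k, 0 <= u k) -> (n <= m)%nat -> sum_n u n <= sum_n u m.
Proof.
intros Hu H; induction H as [|m H IH]; [lra|].
rewrite sum_n_S; generalize (Hu (S m)); lra.
Qed.

Lemma sum_n_le_loc (u v : nat -> R) n :
  (forall k, (k <= n)%nat -> u k <= v k) -> sum_n u n <= sum_n v n.
Proof.
induction n as [|n IH]; intros H; [rewrite !sum_n_0; apply H; lia|].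
rewrite !sum_n_S; apply Rplus_le_compat; [apply IH; intros; apply H|apply H]; lia.
Qed.

Lemma sum_n_Rmult_l (c : R) (u : nat -> R) n :
  sum_n (fun k => c * u k) n = c * sum_n u n :> R.
Proof. exact (sum_n_mult_l c u n). Qed.

Lemma sum_n_Rplus (u v : nat -> R) n :
  sum_n (fun k => u k + v k) n = sum_n u n + sum_n v n :> R.
Proof. exact (sum_n_plus u v n). Qed.

Lemma sum_n_Series_le (u : nat -> R) n :
  (forall k, 0 <= u k) -> ex_series u -> sum_n u n <= Series u.
Proof.
intros Hu Eu; apply (is_lim_seq_incr_compare (sum_n u)).
- exact (Series_correct u Eu).
- intros k; rewrite sum_n_S; generalize (Hu (S k)); lra.
Qed.

Lemma Series_bound (u : nat -> R) M :
  (forall k, 0 <= u k) -> (forall n, sum_n u n <= M) ->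
  ex_series u /\ Series u <= M.
Proof.
intros Hu HM.
assert (Eu : ex_series u).
{ destruct (ex_finite_lim_seq_incr (sum_n u) M) as [l Hl]; trivial.
  - intros k; rewrite sum_n_S; generalize (Hu (S k)); lra.
  - now exists l. }
split; [exact Eu|].
apply (is_lim_seq_le (sum_n u) (fun _ => M) (Series u) M HM).
- exact (Series_correct u Eu).
- apply is_lim_seq_const.
Qed.

Lemma ex_series_comp (u v : nat -> R) :
  (forall k, 0 <= u k <= v k) -> ex_series v -> ex_series u.
Proof.
intros H; apply (ex_series_le (K := R_AbsRing) (V := R_CompleteNormedModule)).
intros n; change (Rabs (u n) <= v n); rewrite Rabs_pos_eq; apply H.
Qed.

Lemma ex_series_lin (c d : R) (u v : nat -> R) : ex_series u -> ex_series v ->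
  ex_series (fun n => c * u n + d * v n).
Proof.
intros Eu Ev.
apply (ex_series_plus (K := R_AbsRing) (V := R_NormedModule)
  (fun n => c * u n) (fun n => d * v n));
  now apply (ex_series_scal (K := R_AbsRing) (V := R_NormedModule)).
Qed.

(** * Real powers: Young's inequality and tangent lines *)

Lemma rpow_add x y z : 0 <= x -> rpow x (y + z) = rpow x y * rpow x z.
Proof.
intros [Hx | <-]; [|rewrite !rpow_0; ring].
now rewrite !rpow_pos, Rpower_plus.
Qed.

Lemma rpow_1 x : 0 <= x -> rpow x 1 = x.
Proof.
intros [Hx | <-]; [rewrite rpow_pos, Rpower_1; trivial | apply rpow_0].
Qed.

Lemma rpow_pred x p : 0 <= x -> rpow x (p - 1) * x = rpow x p.
Proof.
intros Hx; rewrite <- (rpow_1 x) at 2 by assumption.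
rewrite <- rpow_add by assumption; f_equal; ring.
Qed.

Lemma Rpower_gt0 x y : 0 < Rpower x y.
Proof. apply exp_pos. Qed.

Lemma Rpower_Rinv x y : 0 < x -> Rpower (/ x) y = Rpower x (- y).
Proof. intros Hx; unfold Rpower; rewrite ln_Rinv by assumption; f_equal; ring. Qed.

Lemma Rpower_decr x y z : z <= 0 -> 0 < x <= y -> Rpower y z <= Rpower x z.
Proof.
intros Hz Hx; replace z with (- (- z)) by ring; rewrite (Rpower_Ropp x), (Rpower_Ropp y).
apply Rinv_le_contravar; [apply Rpower_gt0 | apply Rle_Rpower_l; lra].
Qed.

(** Bernoulli's inequality at [y / D], multiplied by [D], with equality at [y = D]. Summed over n
    with [D] proportional to B_n, it does the work of Holder's inequality. *)
Lemma young_Rpower D y q : 0 < D -> 0 < y -> 1 < q ->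
  q * y <= Rpower D (1 - q) * Rpower y q + (q - 1) * D.
Proof.
intros HD Hy Hq.
assert (B : 1 + q * (y / D - 1) <= rpow (y / D) q).
{ apply bernoulli_rpow; [|assumption].
  apply Rlt_le, Rdiv_lt_0_compat; assumption. }
rewrite rpow_pos in B by now apply Rdiv_lt_0_compat.
unfold Rdiv in B.
rewrite <- Rpower_mult_distr, Rpower_Rinv in B
  by (trivial; now apply Rinv_0_lt_compat).
apply (Rmult_le_compat_l D) in B; [|lra].
replace (Rpower D (1 - q)) with (D * Rpower D (- q)).
2: { rewrite <- (Rpower_1 D HD) at 1; rewrite <- Rpower_plus; f_equal; ring. }
replace (D * (1 + q * (y * / D - 1))) with (D + q * y - q * D) in B
  by (field; lra).
lra.
Qed.

(** Bernoulli's inequality at [y / x], multiplied by [rpow x p]. Both arguments may be zero, as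
    Cesaro means can be. *)
Lemma young_rpow x y p : 0 <= x -> 0 <= y -> 1 < p ->
  p * (rpow x (p - 1) * y) <= rpow y p + (p - 1) * rpow x p.
Proof.
intros [Hx | <-] Hy Hp; [|rewrite !rpow_0; generalize (rpow_ge0 y p); lra].
assert (B : 1 + p * (y / x - 1) <= rpow (y / x) p).
{ apply bernoulli_rpow; [now apply Rdiv_le_0_compat | assumption]. }
apply (Rmult_le_compat_l (rpow x p)) in B; [|apply rpow_ge0].
assert (E : rpow x p * rpow (y / x) p = rpow y p).
{ rewrite <- rpow_mult; [f_equal; field; lra | lra | now apply Rdiv_le_0_compat]. }
rewrite E, <- (rpow_pred x p) in B by lra.
rewrite <- (rpow_pred x p) by lra.
replace (rpow x (p - 1) * x * (1 + p * (y / x - 1)))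
  with (p * (rpow x (p - 1) * y) - (p - 1) * (rpow x (p - 1) * x)) in B
  by (field; lra).
lra.
Qed.

(** Convexity of t^(1-p), from [1 + z <= exp z]. Taking y = x - 1 bounds (p-1) x^(-p) above by a
    telescoping difference and y = x + 1 bounds it below; this replaces comparison with an
    integral. *)
Lemma Rpower_tangent x y p : 0 < x -> 0 < y -> 1 < p ->
  Rpower x (1 - p) - (p - 1) * Rpower x (- p) * (y - x) <= Rpower y (1 - p).
Proof.
intros Hx Hy Hp.
assert (Hd : 0 < y / x) by now apply Rdiv_lt_0_compat.
assert (L : ln (y / x) <= y / x - 1).
{ generalize (exp_ineq1_le (ln (y / x))); rewrite exp_ln by assumption; lra. }
assert (E : 1 + (1 - p) * ln (y / x) <= Rpower (y / x) (1 - p))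
  by apply exp_ineq1_le.
assert (F : 1 - (p - 1) * (y / x - 1) <= Rpower (y / x) (1 - p)) by nra.
apply (Rmult_le_compat_l (Rpower x (1 - p))) in F;
  [|apply Rlt_le, Rpower_gt0].
rewrite Rpower_mult_distr in F by assumption.
replace (x * (y / x)) with y in F by (field; lra).
replace (Rpower x (1 - p)) with (x * Rpower x (- p)) in F |- *.
2: { rewrite <- (Rpower_1 x Hx) at 1; rewrite <- Rpower_plus; f_equal; ring. }
replace (x * Rpower x (- p) * (1 - (p - 1) * (y / x - 1))) with
  (x * Rpower x (- p) - (p - 1) * Rpower x (- p) * (y - x)) in F
  by (field; lra).
exact F.
Qed.

(** * The zeta series on the real axis *)

Lemma INR_S_gt0 n : 0 < INR (S n).
Proof. apply lt_0_INR; lia. Qed.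

Lemma ex_series_zeta p : 1 < p ->
  ex_series (fun n => Rpower (INR (S n)) (- p)).
Proof.
intros Hp.
apply (Series_bound _ (1 + / (p - 1))); intros n; [apply Rlt_le, Rpower_gt0|].
(* The power subtracted on the right makes the induction telescope; at [n = 0] both sides equal
   [p - 1]. *)
assert (B : (p - 1) * sum_n (fun n => Rpower (INR (S n)) (- p)) n
   <= p - Rpower (INR (S n)) (1 - p)).
{ induction n as [|n IH].
  - rewrite sum_n_0; simpl INR; unfold Rpower; rewrite ln_1, !Rmult_0_r, exp_0; lra.
  - rewrite sum_n_S.
    generalize (Rpower_tangent (INR (S (S n))) (INR (S n)) p
      (INR_S_gt0 _) (INR_S_gt0 _) Hp).
    rewrite (S_INR (S n)) at 3. nra. }
generalize (Rpower_gt0 (INR (S n)) (1 - p)); intros B2.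
apply (Rmult_le_reg_l (p - 1)); [lra|].
rewrite Rmult_plus_distr_l, Rinv_r by lra; lra.
Qed.

Lemma Rpower_lim0 r : 0 < r ->
  is_lim_seq (fun n => Rpower (INR (S n)) (- r)) 0.
Proof.
intros Hr; apply is_lim_seq_spec; intros eps.
destruct (nfloor_ex (Rpower eps (- / r))) as [N HN];
  [apply Rlt_le, Rpower_gt0|].
exists N; intros n Hn.
rewrite Rminus_0_r, Rabs_pos_eq by apply Rlt_le, Rpower_gt0.
assert (H : Rpower eps (- / r) < INR (S n)).
{ apply Rlt_le_trans with (INR N + 1); [apply HN|].
  rewrite <- S_INR; apply le_INR; lia. }
apply ln_increasing in H; [|apply Rpower_gt0].
unfold Rpower in H at 1; rewrite ln_exp in H.
unfold Rpower; rewrite <- (exp_ln eps) by apply cond_pos.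
apply exp_increasing.
apply (Rmult_lt_compat_l r) in H; [|assumption].
replace (r * (- / r * ln eps)) with (- ln eps) in H by (field; lra).
lra.
Qed.

(** * Tails of series, summation by parts and Abel summation *)

Definition tail (c : nat -> R) (n : nat) : R := Series (fun k => c (n + k)%nat).

Lemma ex_series_tail (c : nat -> R) n :
  ex_series c -> ex_series (fun k => c (n + k)%nat).
Proof.
intros Hc; now apply (ex_series_incr_n (K := R_AbsRing) (V := R_NormedModule)).
Qed.

Lemma tail_S (c : nat -> R) n : ex_series c -> tail c n = c n + tail c (S n).
Proof.
intros Hc; unfold tail; rewrite Series_incr_1 by now apply ex_series_tail.
rewrite Nat.add_0_r; f_equal; apply Series_ext; intros k; f_equal; lia.
Qed.

Lemma Series_sum_tail (c : nat -> R) n :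
  ex_series c -> Series c = sum_n c n + tail c (S n).
Proof.
intros Hc; induction n as [|n IH].
- rewrite sum_n_0; exact (Series_incr_1 c Hc).
- rewrite IH, sum_n_S, (tail_S c (S n)) by assumption; ring.
Qed.

Lemma tail_ge0 (c : nat -> R) n :
  (forall k, 0 <= c k) -> ex_series c -> 0 <= tail c n.
Proof.
intros Hc Ec; apply Series_ge0; [intros; apply Hc | now apply ex_series_tail].
Qed.

Lemma tail_decr (c : nat -> R) n m : (forall k, 0 <= c k) -> ex_series c ->
  (n <= m)%nat -> tail c m <= tail c n.
Proof.
intros Hc Ec H; induction H as [|m H IH]; [lra|].
rewrite tail_S in IH by assumption; generalize (Hc m); lra.
Qed.

(** Telescoping the tangent bounds over [k] steps leaves the remainder (n+k+1)^(1-p), which tends to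
    0 because [1 < p]. *)
Lemma tail_zeta_ge p n : 1 < p ->
  Rpower (INR (S n)) (1 - p)
    <= (p - 1) * tail (fun k => Rpower (INR (S k)) (- p)) n.
Proof.
intros Hp.
assert (Ec := ex_series_zeta p Hp).
set (c := fun k => Rpower (INR (S k)) (- p)) in *.
assert (Step : forall k, Rpower (INR (S n)) (1 - p)
  <= Rpower (INR (S (k + n))) (1 - p) + (p - 1) * tail c n).
{ intros k.
  apply Rle_trans with (Rpower (INR (S (k + n))) (1 - p)
    + (p - 1) * (tail c n - tail c (k + n))).
  2: { assert (0 <= tail c (k + n));
       [apply tail_ge0; [intros; apply Rlt_le, Rpower_gt0|exact Ec]|nra]. }
  induction k as [|k IH]; [simpl; lra|].
  rewrite (tail_S c (k + n)) in IH by assumption.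
  generalize (Rpower_tangent (INR (S (k + n))) (INR (S (S k + n))) p
    (INR_S_gt0 _) (INR_S_gt0 _) Hp).
  rewrite (S_INR (S k + n)) at 1; simpl Nat.add.
  unfold c in IH at 2; nra. }
apply (is_lim_seq_le (fun _ => Rpower (INR (S n)) (1 - p)) _
  (Rpower (INR (S n)) (1 - p)) ((p - 1) * tail c n) Step).
- apply is_lim_seq_const.
- replace (Finite ((p - 1) * tail c n)) with (Finite (0 + (p - 1) * tail c n))
    by (f_equal; ring).
  apply (is_lim_seq_plus' _ _ 0 ((p - 1) * tail c n)); [|apply is_lim_seq_const].
  apply (is_lim_seq_incr_n (fun k => Rpower (INR (S k)) (1 - p)) n).
  replace (1 - p) with (- (p - 1)) by ring; apply Rpower_lim0; lra.
Qed.

(** The finite identity has a boundary term A_N B_(N+1), with A_n the partial sums of [a] and B_n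
    the tails of [c]. Since A_k >= A_N for k > N, the rest of the series on the right covers it. *)
Lemma summation_by_parts_le (a c : nat -> R) N :
  (forall k, 0 <= a k) -> (forall k, 0 <= c k) -> ex_series c ->
  ex_series (fun n => sum_n a n * c n) ->
  sum_n (fun n => a n * tail c n) N <= Series (fun n => sum_n a n * c n).
Proof.
intros Ha Hc Ec Es.
assert (E : sum_n (fun n => a n * tail c n) N
  = sum_n (fun n => sum_n a n * c n) N + sum_n a N * tail c (S N) :> R).
{ induction N as [|N IH].
  - rewrite !sum_n_0, tail_S by assumption; ring.
  - rewrite !sum_n_S, IH, (tail_S c (S N)) by assumption; ring. }
rewrite E, (Series_sum_tail _ N Es); apply Rplus_le_compat_l.
unfold tail at 1; rewrite <- Series_scal_l; apply Series_le.
- intros k; split; [apply Rmult_le_pos; trivial; now apply sum_n_ge0|].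
  apply Rmult_le_compat_r; trivial; apply sum_n_incr; trivial; lia.
- exact (ex_series_tail (fun n => sum_n a n * c n) (S N) Es).
Qed.

(** The induction carries the slack between [K * INR (S N)] and the partial sum of [w], times [x N].
    The slack is nonnegative, so passing from [x N] to the smaller [x (S N)] only helps. *)
Lemma abel_le (w x : nat -> R) (K : R) N : (forall k, 0 <= x k) ->
  (forall k, x (S k) <= x k) ->
  (forall k, sum_n w k <= K * INR (S k)) ->
  sum_n (fun k => w k * x k) N <= K * sum_n x N.
Proof.
intros Hx Dx HW.
assert (E : sum_n (fun k => w k * x k) N
  + (K * INR (S N) - sum_n w N) * x N <= K * sum_n x N).
{ induction N as [|N IH].
  - rewrite !sum_n_0; simpl INR; apply Req_le; ring.
  - rewrite !sum_n_S, (S_INR (S N)).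
    generalize (HW N) (Dx N); nra. }
generalize (HW N) (Hx N); nra.
Qed.


(** * Conjugate exponents and Hardy's inequality *)

Lemma conj_exponent p q : 1 < p -> / p + / q = 1 -> 1 < q /\ p * (q - 1) = q.
Proof.
intros Hp Hq.
assert (Hq0 : q <> 0).
(* With the convention [/ 0 = 0], the value [q = 0] would force [/ p = 1]. *)
{ intros ->; rewrite Rinv_0 in Hq.
  assert (/ p < 1) by (rewrite <- Rinv_1; apply Rinv_lt_contravar; lra); lra. }
assert (E : p * (q - 1) = q).
{ replace (p * (q - 1)) with (p * q * 1 - p) by ring.
  rewrite <- Hq; field; split; lra. }
split; [nra | exact E].
Qed.

(** Real counterpart of [cesaro_mean], without the moduli: the inequalities are proved for
    nonnegative sequences and later applied to the moduli of the coefficients. *)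
Definition mean (a : nat -> R) (n : nat) : R := / INR (S n) * sum_n a n.

Lemma mean_ge0 a n : (forall k, 0 <= a k) -> 0 <= mean a n.
Proof.
intros Ha; apply Rmult_le_pos; [|now apply sum_n_ge0].
apply Rlt_le, Rinv_0_lt_compat, INR_S_gt0.
Qed.

Lemma mean_mult a n : INR (S n) * mean a n = sum_n a n.
Proof. unfold mean; generalize (INR_S_gt0 n); intros; field; lra. Qed.

Lemma hardy (p q : R) (a : nat -> R) N :
  1 < p -> / p + / q = 1 -> (forall k, 0 <= a k) ->
  sum_n (fun n => rpow (mean a n) p) N
    <= rpow q p * sum_n (fun n => rpow (a n) p) N.
Proof.
intros Hp Hq Ha.
destruct (conj_exponent p q Hp Hq) as [Hq1 Hpq].
(* Each [m_n^p - q m_n^(p-1) a_n] is at most the n-th increment of the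
   right-hand side, by Young's inequality. *)
assert (T : sum_n (fun n => rpow (mean a n) p) N
    - q * sum_n (fun n => rpow (mean a n) (p - 1) * a n) N
  <= - (q - 1) * INR (S N) * rpow (mean a N) p).
{ induction N as [|N IH].
  - rewrite !sum_n_0.
    assert (E : a 0%nat = mean a 0).
    { unfold mean; rewrite sum_n_0; simpl INR; field. }
    rewrite E; rewrite rpow_pred by now apply mean_ge0.
    simpl INR; lra.
  - rewrite !sum_n_S.
    assert (E : a (S N) = (INR (S N) + 1) * mean a (S N) - INR (S N) * mean a N).
    { rewrite <- S_INR, !mean_mult, sum_n_S; ring. }
    rewrite E.
    generalize (young_rpow (mean a (S N)) (mean a N) p
      (mean_ge0 a _ Ha) (mean_ge0 a _ Ha) Hp).
    rewrite <- (rpow_pred (mean a (S N)) p) by now apply mean_ge0.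
    rewrite (S_INR (S N)).
    set (x := rpow (mean a (S N)) (p - 1)) in *.
    set (y := rpow (mean a N) p) in *.
    intros Y.
    assert (Y' : q * (x * mean a N) <= (q - 1) * y + x * mean a (S N)).
    { apply (Rmult_le_compat_l (q - 1)) in Y; [|lra].
      rewrite <- Rmult_assoc, (Rmult_comm (q - 1) p), Hpq in Y.
      replace (x * mean a (S N)) with ((q - 1) * ((p - 1) * (x * mean a (S N))));
        [lra|].
      rewrite <- Rmult_assoc; replace ((q - 1) * (p - 1)) with 1 by lra; ring. }
    generalize (INR_S_gt0 N); intros HN.
    apply (Rmult_le_compat_l (INR (S N))) in Y'; [|lra].
    nra. }
(* Young's inequality with [y = q * a n]. Inserted into [p] times [T], its term with factor [p - 1]
   is absorbed on the left, which leaves the constant [rpow q p]. *)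
assert (Y : p * q * sum_n (fun n => rpow (mean a n) (p - 1) * a n) N
  <= rpow q p * sum_n (fun n => rpow (a n) p) N
     + (p - 1) * sum_n (fun n => rpow (mean a n) p) N).
{ rewrite <- !sum_n_Rmult_l, <- sum_n_Rplus.
  apply sum_n_le_loc; intros k _.
  rewrite <- rpow_mult by (trivial; lra).
  eapply Rle_trans; [|apply young_rpow; trivial].
  - apply Req_le; ring.
  - now apply mean_ge0.
  - apply Rmult_le_pos; [lra | apply Ha]. }
assert (P : 0 <= (q - 1) * INR (S N) * rpow (mean a N) p).
{ apply Rmult_le_pos; [|apply rpow_ge0].
  apply Rmult_le_pos; [lra | apply Rlt_le, INR_S_gt0]. }
nra.
Qed.

(** * The two upper bounds, for nonnegative sequences *)

Lemma zeta_ge1 x : 1 < x -> 1 <= zeta x.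
Proof.
intros Hx; replace 1 with (Rpower (INR 1) (- x)).
- apply (Series_ge_term (fun n => Rpower (INR (S n)) (- x)) 0).
  + intros; apply Rlt_le, Rpower_gt0.
  + now apply ex_series_zeta.
- simpl INR; unfold Rpower; rewrite ln_1, Rmult_0_r; apply exp_0.
Qed.

(** Tails decrease, so every tail up to [N] is at least one number [D], obtained by replacing all
    later A_k by A_N. As (p-1)(q-1) = 1, the power D^(1-q) is (p-1)^(q-1) (N+1) / A_N, and summing
    the [a n] cancels A_N. *)
Lemma tail_factor_bound (p q : R) (a : nat -> R) (c : nat -> R) N :
  1 < p -> / p + / q = 1 -> (forall k, 0 <= a k) ->
  (forall k, c k = rpow (sum_n a k) (p - 1) * Rpower (INR (S k)) (- p)) ->
  ex_series c ->
  sum_n (fun n => a n * Rpower (tail c n) (1 - q)) N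
    <= Rpower (p - 1) (q - 1) * INR (S N).
Proof.
intros Hp Hq Ha Hc Ec.
destruct (conj_exponent p q Hp Hq) as [Hq1 Hpq].
assert (Pc : forall k, 0 <= c k).
{ intros k; rewrite Hc; apply Rmult_le_pos;
    [apply rpow_ge0 | apply Rlt_le, Rpower_gt0]. }
destruct (sum_n_ge0 a N Ha) as [HA | HA].
- assert (HB : rpow (sum_n a N) (p - 1) * (Rpower (INR (S N)) (1 - p) / (p - 1))
    <= tail c N).
  { apply Rle_trans with (rpow (sum_n a N) (p - 1)
      * tail (fun k => Rpower (INR (S k)) (- p)) N).
    - apply Rmult_le_compat_l; [apply rpow_ge0|].
      apply (Rmult_le_reg_l (p - 1)); [lra|].
      eapply Rle_trans; [|now apply tail_zeta_ge].
      apply Req_le; field; lra.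
    - unfold tail; rewrite <- Series_scal_l; apply Series_le.
      + intros k; rewrite Hc; split.
        * apply Rmult_le_pos; [apply rpow_ge0 | apply Rlt_le, Rpower_gt0].
        * apply Rmult_le_compat_r; [apply Rlt_le, Rpower_gt0|].
          apply rpow_le; [lra | apply sum_n_incr; [trivial | lia]].
      + now apply ex_series_tail. }
  rewrite rpow_pos in HB by assumption.
  set (D := Rpower (sum_n a N) (p - 1) * (Rpower (INR (S N)) (1 - p) / (p - 1))) in *.
  assert (HD : 0 < D).
  { apply Rmult_lt_0_compat; [apply Rpower_gt0|].
    apply Rdiv_lt_0_compat; [apply Rpower_gt0 | lra]. }
  assert (ED : Rpower D (1 - q)
    = / sum_n a N * (INR (S N) * Rpower (p - 1) (q - 1))).
  { assert (e : (p - 1) * (1 - q) = - (1)) by lra.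
    unfold D, Rdiv.
    rewrite <- !Rpower_mult_distr; try apply Rpower_gt0;
      try apply Rinv_0_lt_compat; try lra.
    2: { apply Rmult_lt_0_compat; [apply Rpower_gt0|].
         apply Rinv_0_lt_compat; lra. }
    rewrite !Rpower_mult, e, Rpower_Rinv by lra.
    replace ((1 - p) * (1 - q)) with 1 by lra.
    rewrite Rpower_Ropp, !Rpower_1 by (trivial; apply INR_S_gt0).
    now replace (- (1 - q)) with (q - 1) by ring. }
  apply Rle_trans with (sum_n (fun n => Rpower D (1 - q) * a n) N).
  + apply sum_n_le_loc; intros k Hk; rewrite Rmult_comm.
    apply Rmult_le_compat_r; trivial.
    apply Rpower_decr; [lra|]; split; trivial.
    eapply Rle_trans; [exact HB | now apply tail_decr].
  + rewrite sum_n_Rmult_l, ED; apply Req_le; field; lra.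
(* Here A_N = 0, so each [a k] with [k <= N] vanishes and the value of [Rpower] at a possibly zero
   tail has no effect. *)
- apply Rle_trans with (sum_n (fun _ => 0) N).
  + apply sum_n_le_loc; intros k Hk.
    assert (H : sum_n a k = 0).
    { apply Rle_antisym; [|now apply sum_n_ge0].
      rewrite HA; now apply sum_n_incr. }
    replace (a k) with 0; [lra|].
    destruct k as [|k]; [now rewrite sum_n_0 in H|].
    rewrite sum_n_S in H; generalize (sum_n_ge0 a k Ha) (Ha (S k)); lra.
  + rewrite sum_n_const, Rmult_0_r.
    apply Rmult_le_pos; apply Rlt_le; [apply Rpower_gt0 | apply INR_S_gt0].
Qed.

(** Identifies the series produced by summation by parts with the p-th power of the Cesaro norm. *)
Lemma mean_rpow_pred (p : R) (a : nat -> R) n : (forall k, 0 <= a k) ->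
  sum_n a n * (rpow (sum_n a n) (p - 1) * Rpower (INR (S n)) (- p))
    = rpow (mean a n) p.
Proof.
intros Ha; unfold mean.
generalize (INR_S_gt0 n); intros Hn.
assert (Hi : 0 < / INR (S n)) by now apply Rinv_0_lt_compat.
rewrite rpow_mult, (rpow_pos (/ INR (S n))), Rpower_Rinv; trivial;
  [|lra|now apply sum_n_ge0].
rewrite <- (rpow_pred (sum_n a n) p) by now apply sum_n_ge0.
ring.
Qed.

Lemma ces_pairing_le (p q s : R) (a : nat -> R) N :
  1 < p -> / p + / q = 1 -> / q < s -> (forall k, 0 <= a k) ->
  ex_series (fun n => rpow (mean a n) p) ->
  Series (fun n => rpow (mean a n) p) <= 1 ->
  sum_n (fun n => a n * Rpower (INR (S n)) (- s)) N
    <= Rpower (p - 1) (/ p) * Rpower (zeta (s * q)) (/ q).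
Proof.
intros Hp Hq Hs Ha Es Ls.
destruct (conj_exponent p q Hp Hq) as [Hq1 Hpq].
assert (Hsq : 1 < s * q).
{ apply (Rmult_lt_compat_r q) in Hs; [|lra]; rewrite Rinv_l in Hs; lra. }
set (c := fun k => rpow (sum_n a k) (p - 1) * Rpower (INR (S k)) (- p)).
assert (Pc : forall k, 0 <= c k).
{ intros k; apply Rmult_le_pos; [apply rpow_ge0 | apply Rlt_le, Rpower_gt0]. }
assert (EAc : forall n, sum_n a n * c n = rpow (mean a n) p)
  by (intros; now apply mean_rpow_pred).
(* [c k] is the (p-1)-th power of the mean divided by k+1, so Young's inequality dominates it by two
   summable sequences. *)
assert (Ec : ex_series c).
{ apply (ex_series_comp _ (fun n => 1 * Rpower (INR (S n)) (- p)
    + (p - 1) * rpow (mean a n) p)).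
  2: { apply ex_series_lin; [now apply ex_series_zeta | assumption]. }
  intros k; split; [apply Pc|].
  assert (Hk : 0 < / INR (S k)) by apply Rinv_0_lt_compat, INR_S_gt0.
  generalize (young_rpow (mean a k) (/ INR (S k)) p
    (mean_ge0 a k Ha) (Rlt_le _ _ Hk) Hp).
  rewrite (rpow_pos (/ _)), Rpower_Rinv by (trivial; apply INR_S_gt0).
  replace (rpow (mean a k) (p - 1) * / INR (S k)) with (c k).
  - generalize (Pc k); nra.
  - unfold c, mean.
    rewrite rpow_mult, (rpow_pos (/ _)), Rpower_Rinv; trivial;
      [|apply INR_S_gt0|lra|now apply sum_n_ge0].
    rewrite <- (Rpower_1 (/ INR (S k))), Rpower_Rinv by (trivial; apply INR_S_gt0).
    replace (- p) with (- (p - 1) + - (1)) by ring.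
    rewrite Rpower_plus; ring. }
assert (SB : sum_n (fun n => a n * tail c n) N <= 1).
{ eapply Rle_trans; [apply summation_by_parts_le; trivial|].
  - apply (ex_series_ext (fun n => rpow (mean a n) p)); [|exact Es].
    intros n; symmetry; apply EAc.
  - now rewrite (Series_ext _ (fun n => rpow (mean a n) p)). }
assert (SW : sum_n (fun n => a n * Rpower (tail c n) (1 - q)
     * Rpower (INR (S n)) (- (s * q))) N
   <= Rpower (p - 1) (q - 1) * zeta (s * q)).
{ eapply Rle_trans;
    [apply abel_le with (K := Rpower (p - 1) (q - 1))|].
  - intros; apply Rlt_le, Rpower_gt0.
  - intros k; apply Rpower_decr; [lra|]; split; [apply INR_S_gt0|].
    apply le_INR; lia.
  - intros k; now apply (tail_factor_bound p q a c).
  - apply Rmult_le_compat_l; [apply Rlt_le, Rpower_gt0|].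
    apply sum_n_Series_le; [intros; apply Rlt_le, Rpower_gt0|].
    now apply ex_series_zeta. }
set (M := Rpower (p - 1) (/ p) * Rpower (zeta (s * q)) (/ q)).
assert (HM : 0 < M) by (apply Rmult_lt_0_compat; apply Rpower_gt0).
(* [M] is the claimed bound. Since q/p = q - 1, its q-th power is the bound in [SW]; hence the two
   estimates below contribute M and (q-1) M, in total q M. *)
assert (EM : Rpower M (1 - q) * (Rpower (p - 1) (q - 1) * zeta (s * q)) = M).
{ replace (Rpower (p - 1) (q - 1) * zeta (s * q)) with (Rpower M q).
  - rewrite <- Rpower_plus; replace (1 - q + q) with 1 by ring.
    now apply Rpower_1.
  - unfold M; rewrite <- Rpower_mult_distr, !Rpower_mult by apply Rpower_gt0.
    rewrite Rinv_l, Rpower_1; [|generalize (zeta_ge1 _ Hsq); lra|lra].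
    do 2 f_equal; apply (Rmult_eq_reg_l p); [|lra].
    rewrite Hpq; field; lra. }
assert (Y : q * sum_n (fun n => a n * Rpower (INR (S n)) (- s)) N
  <= Rpower M (1 - q) * sum_n (fun n => a n * Rpower (tail c n) (1 - q)
       * Rpower (INR (S n)) (- (s * q))) N
     + (q - 1) * M * sum_n (fun n => a n * tail c n) N).
{ rewrite <- !sum_n_Rmult_l, <- sum_n_Rplus; apply sum_n_le_loc; intros k _.
  (* Where [a k = 0] the tail may vanish too, while Young's inequality is applied with the positive
     number [D = M * tail c k]. *)
  destruct (Ha k) as [Hak | Hak]; [|rewrite <- Hak; lra].
  assert (HB : 0 < tail c k).
  { rewrite tail_S by assumption.
    apply Rplus_lt_le_0_compat; [|now apply tail_ge0].
    apply Rmult_lt_0_compat; [|apply Rpower_gt0].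
    apply rpow_gt0; destruct k as [|k]; [now rewrite sum_n_0|].
    rewrite sum_n_S; generalize (sum_n_ge0 a k Ha); lra. }
  generalize (young_Rpower (M * tail c k) (Rpower (INR (S k)) (- s)) q
    (Rmult_lt_0_compat _ _ HM HB) (Rpower_gt0 _ _) Hq1).
  rewrite <- Rpower_mult_distr, Rpower_mult by trivial.
  replace (- s * q) with (- (s * q)) by ring.
  intros Y; apply (Rmult_le_compat_l (a k)) in Y; [|lra].
  nra. }
apply (Rmult_le_reg_l q); [lra|].
apply (Rle_trans _ _ _ Y).
apply Rle_trans with (M + (q - 1) * M * 1); [|lra].
apply Rplus_le_compat.
- rewrite <- EM at 2; apply Rmult_le_compat_l; trivial.
  apply Rlt_le, Rpower_gt0.
- apply Rmult_le_compat_l; [|exact SB].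
  apply Rmult_le_pos; lra.
Qed.

(* The functional [a -> sum_k a_k T_k / zeta p] of the header attains its norm
   at the constant Dirichlet series [1]; this is why the bound is sharp. *)
Lemma ces_pairing_le_large (p s : R) (a : nat -> R) N :
  1 < p -> (p - 1) * zeta p <= Rpower 2 (s - (p - 1)) -> p - 1 <= s ->
  (forall k, 0 <= a k) ->
  ex_series (fun n => rpow (mean a n) p) ->
  Series (fun n => rpow (mean a n) p) <= 1 ->
  sum_n (fun n => a n * Rpower (INR (S n)) (- s)) N <= Rpower (zeta p) (- / p).
Proof.
intros Hp Hs Hs' Ha Es Ls.
assert (Z1 := zeta_ge1 p Hp).
set (c := fun k => Rpower (INR (S k)) (- p)).
assert (Pc : forall k, 0 < c k) by (intros; apply Rpower_gt0).
assert (Ec : ex_series c) by now apply ex_series_zeta.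
set (M := Rpower (zeta p) (- / p)).
assert (HM : 0 < M) by apply Rpower_gt0.
assert (HMp : Rpower M p = / zeta p).
{ unfold M; rewrite Rpower_mult.
  replace (- / p * p) with (- (1)) by (field; lra).
  now rewrite Rpower_Ropp, Rpower_1 by lra. }
(* Young's inequality at x = M/(n+1). These are the means of the sequence (M, 0, 0, ...), which has
   norm 1 and is the expected extremal. *)
assert (Y : forall n, p * (sum_n a n * (Rpower M (p - 1) * c n))
  <= 1 * rpow (mean a n) p + (p - 1) * / zeta p * c n).
{ intros n; assert (Hi : 0 < / INR (S n)) by apply Rinv_0_lt_compat, INR_S_gt0.
  assert (Hx : 0 < M * / INR (S n)) by now apply Rmult_lt_0_compat.
  generalize (young_rpow (M * / INR (S n)) (mean a n) p
    (Rlt_le _ _ Hx) (mean_ge0 a n Ha) Hp).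
  rewrite !(rpow_pos (_ * _)), <- !Rpower_mult_distr, HMp, !Rpower_Rinv
    by (trivial; apply INR_S_gt0).
  fold (c n); unfold mean at 1.
  replace (Rpower M (p - 1) * Rpower (INR (S n)) (- (p - 1))
      * (/ INR (S n) * sum_n a n)) with (sum_n a n * (Rpower M (p - 1) * c n));
    [lra|].
  unfold c; replace (- p) with (- (p - 1) + - (1)) by ring.
  rewrite Rpower_plus, (Rpower_Ropp _ 1), Rpower_1 by apply INR_S_gt0; ring. }
assert (PA : forall n, 0 <= sum_n a n * (Rpower M (p - 1) * c n)).
{ intros n; apply Rmult_le_pos; [now apply sum_n_ge0|].
  apply Rlt_le, Rmult_lt_0_compat; [apply Rpower_gt0 | apply Pc]. }
assert (EY := ex_series_lin 1 ((p - 1) * / zeta p) _ _ Es Ec).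
assert (EA : ex_series (fun n => sum_n a n * c n)).
{ apply (ex_series_comp _ (fun n => / (Rpower M (p - 1)) *
    (1 * rpow (mean a n) p + (p - 1) * / zeta p * c n) + 0 * c n)).
  - intros n; split.
    + apply Rmult_le_pos; [now apply sum_n_ge0 | apply Rlt_le, Pc].
    + apply (Rmult_le_reg_l (Rpower M (p - 1))); [apply Rpower_gt0|].
      generalize (Y n) (PA n) (Rpower_gt0 M (p - 1)); intros Y1 P1 G1.
      apply Rle_trans with (1 * rpow (mean a n) p + (p - 1) * / zeta p * c n);
        [nra | apply Req_le; field; lra].
  - exact (ex_series_lin _ 0 _ _ EY Ec). }
(* Summing [Y] gives at most 1 + (p-1) = p, because [c] sums to [zeta p]; then p M^(p-1) is divided
   out. *)
assert (T : sum_n (fun n => a n * tail c n) N <= Rpower M (1 - p)).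
{ eapply Rle_trans.
  { apply summation_by_parts_le; trivial; intros; apply Rlt_le, Pc. }
  apply (Rmult_le_reg_l (p * Rpower M (p - 1))).
  { apply Rmult_lt_0_compat; [lra | apply Rpower_gt0]. }
  rewrite Rmult_assoc, Rmult_assoc, <- Rpower_plus.
  replace (p - 1 + (1 - p)) with 0 by ring; rewrite Rpower_O, Rmult_1_r by trivial.
  rewrite <- !Series_scal_l.
  eapply Rle_trans; [eapply Series_le; [|exact EY]|].
  - intros n; cbv beta; split.
    + replace (p * (Rpower M (p - 1) * (sum_n a n * c n)))
        with (p * (sum_n a n * (Rpower M (p - 1) * c n))) by ring.
      apply Rmult_le_pos; [lra | apply PA].
    + eapply Rle_trans; [|apply Y]; apply Req_le; ring.
  - rewrite Series_plus, !Series_scal_l.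
    + fold (zeta p); change (Series c) with (zeta p).
      rewrite Rmult_assoc, Rinv_l by lra; lra.
    + now apply (ex_series_scal (K := R_AbsRing) (V := R_NormedModule)).
    + now apply (ex_series_scal (K := R_AbsRing) (V := R_NormedModule)). }
(* At index 0 there is equality, as [tail c 0] is [zeta p]. From then on the base is at least 2, so
   the hypothesis on [s] and the lower bound for zeta tails suffice. *)
assert (Dom : forall n, Rpower (INR (S n)) (- s) <= / zeta p * tail c n).
{ intros n; apply (Rmult_le_reg_l (zeta p)); [lra|].
  rewrite <- Rmult_assoc, Rinv_r, Rmult_1_l by lra.
  destruct n as [|n].
  - simpl INR at 1; unfold Rpower at 1; rewrite ln_1, Rmult_0_r, exp_0, Rmult_1_r.
    apply Req_le; reflexivity.
  - apply (Rmult_le_reg_l (p - 1)); [lra|].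
    apply Rle_trans with (Rpower (INR (S (S n))) (1 - p));
      [|now apply tail_zeta_ge].
    replace (1 - p) with (s - (p - 1) + - s) by ring; rewrite Rpower_plus.
    rewrite <- Rmult_assoc; apply Rmult_le_compat_r;
      [apply Rlt_le, Rpower_gt0|].
    apply (Rle_trans _ _ _ Hs), Rle_Rpower_l; [lra|].
    split; [lra|]; change 2 with (INR 2); apply le_INR; lia. }
apply Rle_trans with (sum_n (fun n => / zeta p * (a n * tail c n)) N).
- apply sum_n_le_loc; intros k _.
  rewrite <- Rmult_assoc, (Rmult_comm _ (a k)), Rmult_assoc.
  now apply Rmult_le_compat_l.
- rewrite sum_n_Rmult_l, <- HMp.
  apply Rle_trans with (Rpower M p * Rpower M (1 - p)).
  + apply Rmult_le_compat_l; [apply Rlt_le, Rpower_gt0 | exact T].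
  + rewrite <- Rpower_plus; replace (p + (1 - p)) with 1 by ring.
    rewrite Rpower_1 by assumption; lra.
Qed.


(** The sequence is divided by any [r] exceeding its norm rather than by the norm itself, which also
    covers norm zero; then [r] tends to the norm. As [M] may have either sign, the final margin is
    measured with [Rabs M + 1]. *)
Lemma unit_ball_homogeneity (p M : R) (a x : nat -> R) N : 1 < p ->
  (forall b, (forall k, 0 <= b k) -> ex_series (fun n => rpow (mean b n) p) ->
    Series (fun n => rpow (mean b n) p) <= 1 -> sum_n (fun n => b n * x n) N <= M) ->
  (forall k, 0 <= a k) -> ex_series (fun n => rpow (mean a n) p) ->
  sum_n (fun n => a n * x n) N
    <= M * rpow (Series (fun n => rpow (mean a n) p)) (/ p).
Proof.
intros Hp HM Ha Ea.
set (T := Series (fun n => rpow (mean a n) p)).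
assert (HS : 0 <= T) by (apply Series_ge0; trivial; intros; apply rpow_ge0).
assert (Hr : forall r, rpow T (/ p) < r -> sum_n (fun n => a n * x n) N <= M * r).
{ intros r Hr.
  assert (Pr : 0 < r) by (generalize (rpow_ge0 T (/ p)); lra).
  assert (Pi : 0 < / r) by now apply Rinv_0_lt_compat.
  assert (Em : forall n, rpow (mean (fun k => / r * a k) n) p
    = rpow (/ r) p * rpow (mean a n) p).
  { intros n; unfold mean; rewrite sum_n_Rmult_l, <- rpow_mult.
    - f_equal; ring.
    - lra.
    - now apply mean_ge0. }
  apply (Rmult_le_reg_l (/ r)); [assumption|].
  replace (/ r * (M * r)) with M by (field; lra).
  rewrite <- sum_n_Rmult_l.
  rewrite (sum_n_ext _ (fun n => / r * a n * x n))
    by (intros; symmetry; apply Rmult_assoc).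
  apply HM.
  - intros k; apply Rmult_le_pos; [lra | apply Ha].
  - apply (ex_series_ext (fun n => rpow (/ r) p * rpow (mean a n) p)).
    + intros n; symmetry; apply Em.
    + exact (ex_series_scal (K := R_AbsRing) (V := R_NormedModule) _ _ Ea).
  - rewrite (Series_ext _ _ Em), Series_scal_l; fold T.
    replace 1 with (rpow (/ r) p * rpow r p).
    2: { rewrite <- rpow_mult, Rinv_l, rpow_pos by lra.
         unfold Rpower; rewrite ln_1, Rmult_0_r; apply exp_0. }
    apply Rmult_le_compat_l; [apply rpow_ge0|].
    rewrite <- (rpow_inv_rpow T p) by lra.
    apply rpow_le; lra. }
apply le_epsilon; intros eps He.
set (d := eps / (Rabs M + 1)).
assert (HM1 : 0 < Rabs M + 1) by (generalize (Rabs_pos M); lra).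
assert (Pd : 0 < d) by now apply Rdiv_lt_0_compat.
assert (Ed : (Rabs M + 1) * d = eps) by (unfold d; field; lra).
assert (H := Hr (rpow T (/ p) + d) ltac:(lra)).
generalize (Rle_abs M); nra.
Qed.

(** * Complex series and the point evaluations *)

Lemma Cmod_polar r t : 0 <= r -> Cmod (r * cos t, r * sin t) = r.
Proof.
intros Hr; assert (T := sin2_cos2 t); unfold Rsqr in T.
unfold Cmod; cbn [fst snd].
transitivity (sqrt (r * r)); [f_equal | now apply sqrt_square].
transitivity (r * r * (sin t * sin t + cos t * cos t)); [ring | rewrite T; ring].
Qed.

Lemma Cmod_nat_cpow_opp n s : Cmod (nat_cpow_opp n s) = Rpower (INR n) (- Re s).
Proof.
unfold nat_cpow_opp.
rewrite Ropp_mult_distr_r, <- sin_neg, <- cos_neg.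
apply Cmod_polar, Rlt_le, Rpower_gt0.
Qed.

Lemma filterlim_RtoC (l : R) :
  filterlim RtoC (locally l) (locally (RtoC l : C_NormedModule)).
Proof.
apply filterlim_locally; intros eps; exists eps; intros y Hy; split; simpl.
- exact Hy.
- apply ball_center.
Qed.

Lemma is_series_RtoC (u : nat -> R) (l : R) : is_series u l ->
  is_series (V := C_NormedModule) (fun n => RtoC (u n)) (RtoC l).
Proof.
intros Hu; unfold is_series.
apply (filterlim_ext (fun n => RtoC (sum_n u n))).
- intros n; induction n as [|n IH]; [now rewrite !sum_O|].
  rewrite sum_n_S, RtoC_plus, IH, (sum_Sn (G := C_NormedModule)); reflexivity.
- eapply filterlim_comp; [exact Hu | apply filterlim_RtoC].
Qed.

(** Bounding the moduli of the terms, and not just the value, yields at once absolute convergence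
    (so that the [iota] in [dirichlet] is meaningful), linearity and the norm bound. *)
Definition dominated {p : R} (hp : 1 < p) (s : C) (M : R) : Prop :=
  forall (f : Hces p hp) N,
    sum_n (fun n => Cmod (coef f n) * Rpower (INR (S n)) (- Re s)) N
      <= M * Hces_norm p hp f.

Lemma dominated_intro {p : R} (hp : 1 < p) (s : C) (M : R) :
  (forall a N, (forall k, 0 <= a k) -> ex_series (fun n => rpow (mean a n) p) ->
    Series (fun n => rpow (mean a n) p) <= 1 ->
    sum_n (fun n => a n * Rpower (INR (S n)) (- Re s)) N <= M) ->
  dominated hp s M.
Proof.
intros H f N.
apply (unit_ball_homogeneity p M (fun n => Cmod (coef f n))); trivial.
- intros b; apply H.
- intros; apply Cmod_ge_0.
- exact (coef_ces f).
Qed.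

Lemma delta_unique {p : R} {hp : 1 < p} (s : C) (f : Hces p hp) (l : C) :
  is_series (V := C_NormedModule)
    (fun n => Cmult (coef f n) (nat_cpow_opp (S n) s)) l ->
  delta s f = l.
Proof. exact (iota_filterlim_locally (V := C_CompleteNormedModule) _ l). Qed.

Lemma delta_correct {p : R} (hp : 1 < p) (s : C) (M : R) (f : Hces p hp) :
  dominated hp s M ->
  is_series (V := C_NormedModule)
    (fun n => Cmult (coef f n) (nat_cpow_opp (S n) s)) (delta s f).
Proof.
intros HM.
assert (E : ex_series (V := C_CompleteNormedModule)
  (fun n => Cmult (coef f n) (nat_cpow_opp (S n) s))).
{ apply (ex_series_le (V := C_CompleteNormedModule) _
    (fun n => Cmod (coef f n) * Rpower (INR (S n)) (- Re s))).
  - intros n; apply Req_le; rewrite <- Cmod_nat_cpow_opp; apply Cmod_mult.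
  - apply (Series_bound _ (M * Hces_norm p hp f)); [|apply HM].
    intros k; apply Rmult_le_pos; [apply Cmod_ge_0 | apply Rlt_le, Rpower_gt0]. }
destruct E as [l Hl].
now rewrite (delta_unique s f l Hl).
Qed.

Lemma delta_norm_le {p : R} (hp : 1 < p) (s : C) (M : R) (f : Hces p hp) :
  dominated hp s M -> Cmod (delta s f) <= M * Hces_norm p hp f.
Proof.
intros HM.
assert (L := filterlim_comp _ _ _ _ _ _ _ _ (delta_correct hp s M f HM)
  (filterlim_norm (V := C_NormedModule) (delta s f))).
refine (is_lim_seq_le _ (fun _ => M * Hces_norm p hp f) (Cmod (delta s f))
  (M * Hces_norm p hp f) _ L (is_lim_seq_const _)).
intros N; cbv beta.
eapply Rle_trans; [apply (norm_sum_n_m (V := C_NormedModule))|].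
eapply Rle_trans; [|apply (HM f N)].
apply Req_le, sum_n_m_ext; intros n.
rewrite <- Cmod_nat_cpow_opp; apply Cmod_mult.
Qed.

Lemma delta_is_linear {p : R} (hp : 1 < p) (s : C) (M : R) :
  dominated hp s M ->
  is_linear (delta s : Hces_NormedModule p hp -> C_NormedModule).
Proof.
intros HM; split.
- intros f g; apply delta_unique.
  eapply is_series_ext; [|exact (is_series_plus _ _ _ _
    (delta_correct hp s M f HM) (delta_correct hp s M g HM))].
  intros n; symmetry; apply Cmult_plus_distr_r.
- intros k f; apply delta_unique.
  eapply is_series_ext; [|exact (is_series_scal k _ _
    (delta_correct hp s M f HM))].
  intros n; apply Cmult_assoc.
(* [is_linear] includes boundedness with a positive constant, and [M] is not assumed positive. *)
- exists (Rabs M + 1); split; [generalize (Rabs_pos M); lra|].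
  intros f; eapply Rle_trans; [now apply (delta_norm_le hp s M)|].
  apply Rmult_le_compat_r; [apply rpow_ge0 | generalize (Rle_abs M); lra].
Qed.

(** * Estimates of the operator norm *)

Lemma opnorm_le {K : AbsRing} {U V : NormedModule K} (l : U -> V) (M : R) :
  (forall x, norm x <= 1 -> norm (l x) <= M) -> Rbar_le (opnorm l) M.
Proof.
intros H; apply Lub_Rbar_correct; intros r [x [Hx ->]]; now apply H.
Qed.

Lemma opnorm_ge {U V : NormedModule C_AbsRing} (l : U -> V) (x : U) (r : R) :
  is_linear l -> 0 < r -> norm x <= r -> Rbar_le (norm (l x) / r) (opnorm l).
Proof.
intros Hl Hr Hx.
assert (Pi : 0 < / r) by now apply Rinv_0_lt_compat.
assert (A : @abs C_AbsRing (RtoC (/ r)) = / r).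
{ change (Cmod (RtoC (/ r)) = / r); rewrite Cmod_R; apply Rabs_pos_eq; lra. }
assert (A' : @abs C_AbsRing (RtoC r) = r).
{ change (Cmod (RtoC r) = r); rewrite Cmod_R; apply Rabs_pos_eq; lra. }
apply Rbar_le_trans with (norm (l (scal (RtoC (/ r) : C_AbsRing) x))).
- rewrite (linear_scal _ Hl); simpl.
  apply (Rmult_le_reg_l r); [assumption|].
  replace (r * (norm (l x) / r)) with (norm (l x)) by (field; lra).
  (* [norm_scal] is an inequality; applied to [l x] written as [r] times [/ r] times [l x], it gives
     the reverse estimate. *)
  replace (l x) with (scal (RtoC r : C_AbsRing) (scal (RtoC (/ r) : C_AbsRing) (l x)))
    at 1.
  + eapply Rle_trans; [apply norm_scal|]; rewrite A'; apply Rle_refl.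
  + rewrite scal_assoc; change (scal (Cmult (RtoC r) (RtoC (/ r)) : C_AbsRing) (l x) = l x).
    rewrite <- RtoC_mult, Rinv_r by lra; apply (scal_one (K := C_AbsRing)).
- apply (Lub_Rbar_correct _); eexists; split; [|reflexivity].
  eapply Rle_trans; [apply norm_scal|]; rewrite A.
  apply (Rmult_le_reg_l r); [assumption|].
  rewrite <- Rmult_assoc, Rinv_r, Rmult_1_l, Rmult_1_r by lra; exact Hx.
Qed.

Lemma delta_opnorm_le {p : R} (hp : 1 < p) (s : C) (M : R) :
  0 <= M -> dominated hp s M ->
  Rbar_le (opnorm (delta s : Hces_NormedModule p hp -> C_NormedModule)) M.
Proof.
intros PM HM; apply opnorm_le; intros f Hf.
eapply Rle_trans; [apply (delta_norm_le hp s M f HM)|].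
rewrite <- (Rmult_1_r M) at 2; now apply Rmult_le_compat_l.
Qed.

(** The phases of the test sequence cancel those of n^(-s), so the value is zeta(sigma q). As p(q-1)
    = q, Hardy's inequality bounds the norm by q zeta(sigma q)^(1/p), and the quotient is the
    claim. *)
Lemma delta_opnorm_ge {p q : R} (hp : 1 < p) (s : C) (M : R) :
  / p + / q = 1 -> / q < Re s -> dominated hp s M ->
  Rbar_le (/ q * Rpower (zeta (Re s * q)) (/ q))
    (opnorm (delta s : Hces_NormedModule p hp -> C_NormedModule)).
Proof.
intros Hq Hs HM.
destruct (conj_exponent p q hp Hq) as [Hq1 Hpq].
assert (Hsq : 1 < Re s * q).
{ apply (Rmult_lt_compat_r q) in Hs; [|lra]; rewrite Rinv_l in Hs; lra. }
assert (Z1 := zeta_ge1 _ Hsq).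
set (b := fun n => Rpower (INR (S n)) (- (Re s * (q - 1)))).
set (a := fun n => (b n * cos (Im s * ln (INR (S n))),
  b n * sin (Im s * ln (INR (S n)))) : C).
assert (Pb : forall n, 0 <= b n) by (intros; apply Rlt_le, Rpower_gt0).
assert (Ea : forall n, Cmod (a n) = b n).
{ intros n; now apply Cmod_polar. }
assert (Em : forall n, cesaro_mean a n = mean b n).
{ intros n; unfold cesaro_mean, mean; f_equal; apply sum_n_ext; exact Ea. }
assert (H : ex_series (fun n => rpow (mean b n) p) /\
  Series (fun n => rpow (mean b n) p) <= rpow q p * zeta (Re s * q)).
{ apply Series_bound; [intros; apply rpow_ge0|]; intros n.
  eapply Rle_trans; [now apply (hardy p q)|].
  apply Rmult_le_compat_l; [apply rpow_ge0|].
  rewrite (sum_n_ext _ (fun n => Rpower (INR (S n)) (- (Re s * q)))).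
  - apply sum_n_Series_le; [intros; apply Rlt_le, Rpower_gt0|].
    now apply ex_series_zeta.
  - intros k; unfold b; rewrite rpow_pos, Rpower_mult by apply Rpower_gt0.
    f_equal; rewrite <- Hpq at 2; ring. }
destruct H as [Hex Hle].
assert (Ca : ces p a).
{ apply (ex_series_ext (fun n => rpow (mean b n) p)); [|exact Hex].
  intros n; now rewrite Em. }
set (f := mkHces hp a Ca : Hces_NormedModule p hp).
assert (Nf : norm f <= q * Rpower (zeta (Re s * q)) (/ p)).
{ change (ces_norm p a <= q * Rpower (zeta (Re s * q)) (/ p)); unfold ces_norm.
  rewrite (Series_ext _ (fun n => rpow (mean b n) p))
    by (intros; now rewrite Em).
  eapply Rle_trans; [apply rpow_le; [|exact Hle]|].
  - apply Rlt_le, Rinv_0_lt_compat; lra.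
  - rewrite rpow_mult, rpow_rpow_inv, rpow_pos by (try apply rpow_ge0; lra); lra. }
assert (Df : delta s f = RtoC (zeta (Re s * q))).
{ apply delta_unique.
  apply (is_series_ext (fun n => RtoC (Rpower (INR (S n)) (- (Re s * q))))).
  - intros n; unfold f, a, nat_cpow_opp, Cmult, RtoC; cbn [coef fst snd].
    set (t := Im s * ln (INR (S n))).
    replace (- (Re s * q)) with (- (Re s * (q - 1)) + - Re s) by ring.
    rewrite Rpower_plus; fold (b n); f_equal; [|ring].
    rewrite <- (Rmult_1_r (b n * _)), <- (sin2_cos2 t); unfold Rsqr; ring.
  - apply is_series_RtoC, Series_correct, ex_series_zeta, Hsq. }
assert (Pr : 0 < q * Rpower (zeta (Re s * q)) (/ p))
  by (apply Rmult_lt_0_compat; [lra | apply Rpower_gt0]).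
eapply Rbar_le_trans;
  [|exact (opnorm_ge _ f _ (delta_is_linear hp s M HM) Pr Nf)].
rewrite Df; simpl.
change (norm (RtoC (zeta (Re s * q)))) with (Cmod (RtoC (zeta (Re s * q)))).
rewrite Cmod_R, Rabs_pos_eq by lra.
assert (Ez : zeta (Re s * q) = Rpower (zeta (Re s * q)) (/ p)
   * Rpower (zeta (Re s * q)) (/ q))
  by (rewrite <- Rpower_plus, Hq, Rpower_1; lra).
rewrite Ez at 2; apply Req_le; field; split; [|lra].
apply Rgt_not_eq, Rpower_gt0.
Qed.

(** The test function is the constant 1: its n-th mean is 1/n, so its norm is zeta(p)^(1/p). *)
Lemma delta_opnorm_ge_one {p : R} (hp : 1 < p) (s : C) (M : R) :
  dominated hp s M ->
  Rbar_le (Rpower (zeta p) (- / p))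
    (opnorm (delta s : Hces_NormedModule p hp -> C_NormedModule)).
Proof.
intros HM.
assert (Z1 := zeta_ge1 _ hp).
set (u := fun n : nat => match n with O => 1 | S _ => 0 end).
assert (Su : forall n, sum_n u n = 1 :> R).
{ induction n as [|n IH]; [now rewrite sum_n_0|].
  rewrite sum_n_S, IH; simpl; ring. }
set (a := fun n => RtoC (u n)).
assert (Em : forall n, rpow (cesaro_mean a n) p = Rpower (INR (S n)) (- p)).
{ intros n; unfold cesaro_mean.
  rewrite (sum_n_ext _ u), Su, Rmult_1_r.
  - rewrite rpow_pos; [|apply Rinv_0_lt_compat, INR_S_gt0].
    apply Rpower_Rinv, INR_S_gt0.
  - intros k; unfold a; rewrite Cmod_R.
    apply Rabs_pos_eq; destruct k; simpl; lra. }
assert (Ca : ces p a).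
{ apply (ex_series_ext (fun n => Rpower (INR (S n)) (- p))).
  - intros n; now rewrite Em.
  - now apply ex_series_zeta. }
set (f := mkHces hp a Ca : Hces_NormedModule p hp).
assert (Nf : norm f <= Rpower (zeta p) (/ p)).
{ change (ces_norm p a <= Rpower (zeta p) (/ p)); unfold ces_norm.
  rewrite (Series_ext _ _ Em); fold (zeta p).
  rewrite rpow_pos; lra. }
assert (Df : delta s f = RtoC 1).
{ apply delta_unique.
  apply (is_series_ext (fun n => RtoC (u n))).
  - intros [|n]; unfold f, a; cbn [coef u].
    + unfold nat_cpow_opp, Rpower; simpl INR.
      rewrite ln_1, !Rmult_0_r, exp_0, cos_0, sin_0.
      unfold Cmult, RtoC; cbn [fst snd]; f_equal; ring.
    + symmetry; apply Cmult_0_l.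
  - apply is_series_RtoC.
    refine (is_lim_seq_ext (fun _ => 1) (sum_n u) 1 _ (is_lim_seq_const 1)).
    intros n; symmetry; apply Su. }
eapply Rbar_le_trans;
  [|exact (opnorm_ge _ f _ (delta_is_linear hp s M HM) (Rpower_gt0 _ _) Nf)].
rewrite Df; simpl.
change (norm (RtoC 1)) with (Cmod (RtoC 1)).
rewrite Cmod_1, Rpower_Ropp; apply Req_le; unfold Rdiv; ring.
Qed.

Theorem theorem3p4 (p q : R) (hp : 1 < p) (hq : / p + / q = 1) :
  (forall s0 : C, / q < Re s0 ->
     is_linear (delta s0 : Hces_NormedModule p hp -> C_NormedModule) /\
     Rbar_le (/ q * Rpower (zeta (Re s0 * q)) (/ q))
       (opnorm (delta s0 : Hces_NormedModule p hp -> C_NormedModule)) /\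
     Rbar_le (opnorm (delta s0 : Hces_NormedModule p hp -> C_NormedModule))
       (Rpower (p - 1) (/ p) * Rpower (zeta (Re s0 * q)) (/ q))) /\
  (exists sigma_p : R, forall s0 : C,
     / q < Re s0 -> sigma_p <= Re s0 ->
     opnorm (delta s0 : Hces_NormedModule p hp -> C_NormedModule)
       = Finite (Rpower (zeta p) (- / p))).
Proof.
assert (HD : forall s0 : C, / q < Re s0 ->
  dominated hp s0 (Rpower (p - 1) (/ p) * Rpower (zeta (Re s0 * q)) (/ q))).
{ intros s0 Hs; apply dominated_intro; intros a N; now apply ces_pairing_le. }
split.
- intros s0 Hs; split; [|split].
  + exact (delta_is_linear hp s0 _ (HD s0 Hs)).
  + exact (delta_opnorm_ge hp s0 _ hq Hs (HD s0 Hs)).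
  + apply (delta_opnorm_le hp s0 _); [|now apply HD].
    apply Rmult_le_pos; apply Rlt_le, Rpower_gt0.
(* [L] solves 2^L = (p-1) zeta(p). The maximum with 0 secures [p - 1 <= Re s0], the other condition
   of [ces_pairing_le_large]; the threshold involves [p] alone. *)
- set (L := ln ((p - 1) * zeta p) / ln 2).
  exists (p - 1 + Rmax L 0); intros s0 _ Hs.
  assert (Z1 := zeta_ge1 _ hp).
  assert (l2 : 0 < ln 2) by (rewrite <- ln_1; apply ln_increasing; lra).
  assert (D : dominated hp s0 (Rpower (zeta p) (- / p))).
  { apply dominated_intro; intros a N; apply ces_pairing_le_large; trivial.
    - rewrite <- (exp_ln ((p - 1) * zeta p)) by nra.
      replace (ln ((p - 1) * zeta p)) with (L * ln 2) by (unfold L; field; lra).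
      apply Rle_Rpower; [lra | generalize (Rmax_l L 0); lra].
    - generalize (Rmax_r L 0); lra. }
  apply Rbar_le_antisym.
  + apply delta_opnorm_le; [apply Rlt_le, Rpower_gt0 | exact D].
  + exact (delta_opnorm_ge_one hp s0 _ D).
Qed.
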